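(* Let $N\ge 2$ be an integer, $\mu_0,\mu_1\in\mathcal P_2(\mathbb R^d)$, $\gamma\in\Gamma(\mu_0,\mu_1)$ and $\gamma^{(N)}=\mathcal F_N(\gamma)$. Then: (i) $\gamma^{(N)}\in\Gamma(\mu_0,\mu_1)$. (ii) $\int\|x-y\|^2\,d\gamma^{(N)}(x,y)\le\int\|x-y\|^2\,d\gamma(x,y)$. (iii) $\int\|x-y\|^2\,d\gamma^{(N)}(x,y)=\int\|x-y\|^2\,d\gamma(x,y)$ if and only if $\gamma$ is $N$-cyclically monotone. (iv) The mapping $(\mathcal P_2(\mathbb R^d\times\mathbb R^d),W_2)\to(\mathbb R,|\cdot|)$, $\gamma\mapsto\int\|x-y\|^2\,d\mathcal F_N(\gamma)(x,y)$, is continuous.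
   Context: $\mathcal P_2$ denotes Borel probability measures with finite second moment, $W_2$ is the quadratic Wasserstein distance, and $\Gamma(\mu_0,\mu_1)$ is the set of $\gamma\in\mathcal P_2(\mathbb R^d\times\mathbb R^d)$ with first marginal $\mu_0$ and second marginal $\mu_1$. Minibatch OT operator: let $\Sigma_N$ be the group of permutations of $\{1,\dots,N\}$. Fix a Borel map $S=(S_1,\dots,S_N):(\mathbb R^d\times\mathbb R^d)^N\to(\mathbb R^d\times\mathbb R^d)^N$ which sends $(x^{(i)},y^{(i)})_{i=1}^N$ to $(x^{(i)},y^{(\sigma(i))})_{i=1}^N$, where $\sigma$ (depending measurably on the input, otherwise an arbitrary but fixed choice) satisfies $\sigma\in\arg\min_{\tau\in\Sigma_N}\sum_{i=1}^N\|x^{(i)}-y^{(\tau(i))}\|^2$. For $\gamma\in\mathcal P_2(\mathbb R^d\times\mathbb R^d)$ set $\mathcal F_N(\gamma)=\frac1N\sum_{i=1}^N (S_i)_\#\gamma^{\otimes N}$, with $\gamma^{\otimes N}=\gamma\otimes\cdots\otimes\gamma$. A set $A\subset\mathbb R^d\times\mathbb R^d$ is $N$-cyclically monotone if for all $(x^{(1)},y^{(1)}),\dots,(x^{(N)},y^{(N)})\in A$ and all $\tau\in\Sigma_N$ one has $\sum_{i=1}^N\|x^{(i)}-y^{(i)}\|^2\le\sum_{i=1}^N\|x^{(i)}-y^{(\tau(i))}\|^2$. A plan $\gamma\in\mathcal P_2(\mathbb R^d\times\mathbb R^d)$ is $N$-cyclically monotone if $\mathrm{supp}(\gamma)$ is.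 *)

(* Defs.v *)
(* MathComp / MathComp-Analysis. *)
From HB Require Import structures.
From mathcomp Require Import all_boot all_order all_algebra all_fingroup.
From mathcomp Require Import all_classical all_reals all_analysis.

Set Implicit Arguments.
Unset Strict Implicit.
Unset Printing Implicit Defensive.

Import Order.TTheory GRing.Theory Num.Theory.
Import numFieldNormedType.Exports.

Local Open Scope classical_set_scope.
Local Open Scope ring_scope.

(* R^d is 'rV[R]_d with the Borel sigma-algebra of its library topology.  On
   R^d x R^d the library puts the product topology and the product
   sigma-algebra; by second countability the latter is the Borel one (and
   likewise for N.-tuple (R^d x R^d)). *)
Section borel_rV.
Variables (R : realType) (d : nat).

HB.instance Definition _ := @isMeasurable.Build
  (sigma_display (@open 'rV[R]_d)) 'rV[R]_d <<s @open 'rV[R]_d >>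
  (@sigma_algebra0 _ setT _) (@sigma_algebraC _ _)
  (@sigma_algebra_bigcup _ setT _).

End borel_rV.

Notation pairs R d := ('rV[R]_d * 'rV[R]_d)%type.

Section euclidean.
Variables (R : realType) (d : nat).

(* The norm `|x| of 'rV[R]_d in the library is the sup norm. *)
Definition enorm (x : 'rV[R]_d) : R := Num.sqrt (\sum_(k < d) x ord0 k ^+ 2).

Definition enorm2 (z : pairs R d) : R :=
  Num.sqrt (enorm z.1 ^+ 2 + enorm z.2 ^+ 2).

End euclidean.

Section wasserstein.
Local Open Scope ereal_scope.
Context {dT : measure_display} {T : measurableType dT} {R : realType}.

Definition finite_second_moment (nrm : T -> R) (mu : probability T R) : Prop :=
  \int[mu]_x ((nrm x ^+ 2)%:E) < +oo.

Definition has_marginals (mu nu : probability T R)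
    (pi : probability (T * T)%type R) : Prop :=
  (forall A, measurable A -> pushforward pi fst A = mu A) /\
  (forall A, measurable A -> pushforward pi snd A = nu A).

Definition W2 (dist : T -> T -> R) (mu nu : probability T R) : \bar R :=
  (ereal_inf [set \int[pi]_z ((dist z.1 z.2 ^+ 2)%:E)
             | pi in has_marginals mu nu]) `^ (2^-1).

End wasserstein.

Section plans.
Variables (R : realType) (d : nat).

Definition P2 (mu : probability 'rV[R]_d R) : Prop :=
  finite_second_moment (@enorm R d) mu.

Definition P2_plan (gamma : probability (pairs R d) R) : Prop :=
  finite_second_moment (@enorm2 R d) gamma.

Definition Gamma (mu0 mu1 : probability 'rV[R]_d R)
    (gamma : probability (pairs R d) R) : Prop :=
  P2_plan gamma /\ has_marginals mu0 mu1 gamma.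

Definition W2_plan (gamma gamma' : probability (pairs R d) R) : \bar R :=
  W2 (fun z w : pairs R d => enorm2 (z - w)) gamma gamma'.

Definition transport_cost (gamma : probability (pairs R d) R) : \bar R :=
  (\int[gamma]_z ((enorm (z.1 - z.2) ^+ 2)%:E))%E.

Definition supp (gamma : probability (pairs R d) R) : set (pairs R d) :=
  [set z | forall U : set (pairs R d), open U -> U z -> (0 < gamma U)%E].

Definition N_cyclically_monotone (N : nat) (A : set (pairs R d)) : Prop :=
  forall z : N.-tuple (pairs R d), (forall i, A (tnth z i)) ->
  forall tau : 'S_N,
    \sum_(i < N) enorm ((tnth z i).1 - (tnth z i).2) ^+ 2 <=
    \sum_(i < N) enorm ((tnth z i).1 - (tnth z (tau i)).2) ^+ 2.

Definition N_cyclically_monotone_plan (N : nat)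
    (gamma : probability (pairs R d) R) : Prop :=
  N_cyclically_monotone N (supp gamma).

End plans.

Section power_probability.
Context {dT : measure_display} {T : measurableType dT} {R : realType}.
Variable P : probability T R.

Definition tcons n (x : T * n.-tuple T) : n.+1.-tuple T := [tuple of x.1 :: x.2].

Lemma measurable_tcons n : measurable_fun [set: T * n.-tuple T] (@tcons n).
Proof. exact: measurable_cons. Qed.

HB.instance Definition _ n :=
  isMeasurableFun.Build _ _ _ _ (@tcons n) (@measurable_tcons n).

Fixpoint power_probability (n : nat) : probability (n.-tuple T) R :=
  match n with
  | 0 => dirac [tuple]
  | n'.+1 => distribution (P \x power_probability n')%E (@tcons n')
  end.

Lemma power_probability_rectangle n (A : 'I_n -> set T) :
  (forall i, measurable (A i)) ->
  power_probability n [set t | forall i, A i (tnth t i)] =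
  (\prod_(i < n) P (A i))%E.
Proof.
elim: n A => [|n IH] A mA.
  rewrite big_ord0 /= diracE mem_set//=; by case.
pose B : set (n.-tuple T) := [set t | forall i, A (lift ord0 i) (tnth t i)].
have mB : measurable B.
  rewrite (_ : B = \bigcap_(i in [set: 'I_n])
      ((fun t : n.-tuple T => tnth t i) @^-1` A (lift ord0 i))).
    apply: fin_bigcap_measurable => [|i _]; first exact: finite_finset.
    by rewrite -[X in measurable X]setTI; exact: measurable_tnth.
  by apply/seteqP; split=> [t Bt i _|t h i]; [exact: Bt|exact: h].
rewrite big_ord_recl /= /distribution /pushforward -IH//.
rewrite -product_measure1E//; congr (_ _).
apply/seteqP; split=> [[x t] /= h|[x t] /= [h1 h2] i].
  by split=> [|i]; [exact: (h ord0)|have := h (lift ord0 i); rewrite tnthS].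
by case: (unliftP ord0 i) => [j ->|->//]; rewrite tnthS; exact: h2.
Qed.

End power_probability.

Section minibatch.
Variables (R : realType) (d N : nat).
Local Notation Z := (pairs R d).

Definition batch_cost (z : N.-tuple Z) (tau : 'S_N) : R :=
  \sum_(i < N) enorm ((tnth z i).1 - (tnth z (tau i)).2) ^+ 2.

Definition minibatch_map (S : {mfun N.-tuple Z >-> N.-tuple Z}) : Prop :=
  exists sigma : N.-tuple Z -> 'S_N,
    [/\ forall tau, measurable (sigma @^-1` [set tau]),
        forall z tau, batch_cost z (sigma z) <= batch_cost z tau &
        forall z, S z =
          [tuple ((tnth z i).1, (tnth z (sigma z i)).2) | i < N]].

Variable S : {mfun N.-tuple Z >-> N.-tuple Z}.
Variable gamma : probability Z R.

Definition minibatch_measure (A : set Z) : \bar R :=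
  ((N%:R^-1)%:E * \sum_(i < N)
     pushforward (power_probability gamma N) (fun z => tnth (S z) i) A)%E.

Let measurable_S i : measurable_fun setT (fun z => tnth (S z) i).
Proof.
exact: (measurableT_comp (measurable_tnth i) (@measurable_funPT _ _ _ _ S)).
Qed.

Let S_ (i : 'I_N) : {mfun N.-tuple Z >-> Z} :=
  HB.pack (fun z => tnth (S z) i) (isMeasurableFun.Build _ _ _ _ _ (measurable_S i)).

Let pushforward_S (i : 'I_N) : {measure set Z -> \bar R} :=
  distribution (power_probability gamma N) (S_ i).

Let minibatch0 : minibatch_measure set0 = 0%E.
Proof.
rewrite /minibatch_measure big1 ?mule0// => i _.
exact: (measure0 (pushforward_S i)).
Qed.

Let minibatch_ge0 A : (0 <= minibatch_measure A)%E.
Proof.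
rewrite /minibatch_measure mule_ge0 ?lee_fin ?invr_ge0//.
by apply: sume_ge0 => i _; exact: (measure_ge0 (pushforward_S i)).
Qed.

Let minibatch_sigma_additive : semi_sigma_additive minibatch_measure.
Proof.
pose m (k : nat) : {measure set Z -> \bar R} :=
  oapp pushforward_S mzero (insub k).
rewrite (_ : minibatch_measure = mscale (N%:R^-1)%:nng (msum m N)).
  exact: measure_semi_sigma_additive.
apply/funext => A; rewrite /mscale /msum /minibatch_measure /=.
by congr (_ * _)%E; apply: eq_bigr => i _; rewrite /m valK.
Qed.

HB.instance Definition _ := isMeasure.Build _ _ _ minibatch_measure
  minibatch0 minibatch_ge0 minibatch_sigma_additive.

Lemma minibatch_setT : (0 < N)%N -> minibatch_measure setT = 1%E.
Proof.
move=> N0; rewrite /minibatch_measure.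
under eq_bigr do rewrite /pushforward preimage_setT probability_setT.
rewrite sumEFin sumr_const card_ord -EFinM mulVf ?pnatr_eq0 -?lt0n//.
Qed.

End minibatch.

Definition minibatch_OT (R : realType) (d N : nat) (N_gt0 : (0 < N)%N)
    (S : {mfun N.-tuple (pairs R d) >-> N.-tuple (pairs R d)})
    (gamma : probability (pairs R d) R) : probability (pairs R d) R :=
  HB.pack (minibatch_measure S gamma)
    (Measure_isProbability.Build _ _ _ (minibatch_measure S gamma)
      (minibatch_setT S gamma N_gt0)).

(* Continuity on (P_2(R^d x R^d), W_2), spelled out because P_2 with W_2 is not
   registered as a metric space. *)
Definition W2_continuous (R : realType) (d : nat)
    (J : probability (pairs R d) R -> R) : Prop :=
  forall gamma, P2_plan gamma ->
  forall eps : R, 0 < eps ->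
  exists2 delta : R, 0 < delta &
    forall gamma', P2_plan gamma' -> (W2_plan gamma gamma' < delta%:E)%E ->
      `|J gamma' - J gamma| < eps.

(* Main.v *)
Require Import Defs.
From HB Require Import structures.
From mathcomp Require Import all_boot all_order all_algebra all_fingroup.
From mathcomp Require Import all_classical all_reals all_analysis.
From mathcomp Require Import measurable_realfun ring lra.

Set Implicit Arguments.
Unset Strict Implicit.
Unset Printing Implicit Defensive.

Import Order.TTheory GRing.Theory Num.Theory.
Import numFieldNormedType.Exports.

Local Open Scope classical_set_scope.
Local Open Scope ring_scope.

(* Writing m(z) for the least matching cost of a batch z, the cost of F_N(gamma)
   is the mean of m(z)/N under gamma^N, while that of gamma is the mean of the
   cost of the identity matching divided by N.  Equality of the two thus means
   that the identity is optimal for almost every batch; matching costs being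
   continuous, this is the same as for every batch in supp(gamma)^N.
   For continuity, the square root of the matching cost along a fixed
   permutation is a seminorm of the batch; the weighted inequality
   (a + b)^2 <= (1 + t) a^2 + (1 + 1/t) b^2 yields, after integration against
   the N-th power of a coupling pi of g and g',
     J(g') <= (1 + t) J(g) + 2 (1 + 1/t) \int |z - z'|^2 dpi,
   where J(g) is the cost of F_N(g). *)

(** * Powers of a probability: marginals, sums over coordinates, images *)

Section power_probability.
Local Open Scope ereal_scope.
Context {dT : measure_display} {T : measurableType dT} {R : realType}.
Implicit Types (P : probability T R) (n : nat).

Lemma measurable_tuple_rectangle n (A : 'I_n -> set T) :
  (forall i, measurable (A i)) ->
  measurable [set t : n.-tuple T | forall i, A i (tnth t i)].
Proof.
move=> mA; rewrite (_ : [set _ | _] = \bigcap_(i in [set: 'I_n])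
    ((fun t : n.-tuple T => tnth t i) @^-1` A i)).
  apply: fin_bigcap_measurable => [|i _]; first exact: finite_finset.
  by rewrite -[X in measurable X]setTI; exact: measurable_tnth.
by apply/seteqP; split=> [t At i _|t h i]; [exact: At|exact: h].
Qed.

(** A cylinder over one coordinate is a rectangle whose other sides are the whole space, each
    contributing a factor 1. *)
Lemma power_probability_tnth P n (i : 'I_n) (A : set T) : measurable A ->
  pushforward (power_probability P n) (fun t => tnth t i) A = P A.
Proof.
move=> mA; pose B j := if j == i then A else setT.
have mB j : measurable (B j) by rewrite /B; case: ifP.
transitivity (\prod_(j < n) P (B j)).
  rewrite -power_probability_rectangle// /pushforward; congr (_ _).
  apply/seteqP; split=> [t /= At j|t /(_ i)/=]; rewrite /B ?eqxx//.
  by case: eqP => // ->.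
rewrite (bigD1 i)//= /B eqxx big1 ?mule1// => j /negPf ->.
exact: probability_setT.
Qed.

Lemma ge0_integral_power_tnth P n (i : 'I_n) (f : T -> \bar R) :
  measurable_fun setT f -> (forall x, 0 <= f x) ->
  \int[power_probability P n]_t f (tnth t i) = \int[P]_x f x.
Proof.
move=> mf f0.
rewrite -(ge0_integral_pushforward (measurable_tnth i) _ measurableT mf)//.
apply: eq_measure_integral => [|? A mA _]; first exact: measurable_tnth.
exact: power_probability_tnth.
Qed.

Lemma ge0_integral_power_sum P n (f : T -> \bar R) :
  measurable_fun setT f -> (forall x, 0 <= f x) ->
  \int[power_probability P n]_t (\sum_(i < n) f (tnth t i)) =
  n%:R%:E * \int[P]_x f x.
Proof.
move=> mf f0; rewrite ge0_integral_sum//; last first.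
  by move=> i; exact: measurableT_comp mf (measurable_tnth i).
rewrite (eq_bigr (fun=> \int[P]_x f x)); last first.
  by move=> i _; exact: ge0_integral_power_tnth.
by rewrite sumr_const card_ord mule_natl.
Qed.

Lemma measurable_map_tuple {dT' : measure_display} {T' : measurableType dT'}
    (p : T' -> T) n : measurable_fun setT p ->
  measurable_fun setT (fun t : n.-tuple T' => [tuple p (tnth t i) | i < n]).
Proof.
move=> mp; apply/measurable_fun_tnthP => i /=.
rewrite (_ : _ \o _ = p \o (fun t => tnth t i)); last first.
  by apply/funext => t /=; rewrite tnth_mktuple.
exact: measurableT_comp mp (measurable_tnth i).
Qed.

Lemma mktuple_tcons {dT' : measure_display} {T' : measurableType dT'}
    (p : T' -> T) n (x : T' * n.-tuple T') :
  [tuple p (tnth (tcons x) i) | i < n.+1] =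
  tcons (p x.1, [tuple p (tnth x.2 i) | i < n]).
Proof.
apply: eq_from_tnth => i; rewrite tnth_mktuple.
by case: (unliftP ord0 i) => [j ->|->//]; rewrite !tnthS tnth_mktuple.
Qed.

(** Allows the powers of both marginals of a coupling to be replaced by the power of the coupling
    itself. By induction on [n]: Tonelli splits off the first coordinate, the induction hypothesis
    treats the inner integral with that coordinate frozen, and a change of variables along [p]
    treats the outer one. *)
Lemma ge0_integral_power_map {dT' : measure_display} {T' : measurableType dT'}
    (Q : probability T' R) P (p : T' -> T) n (f : n.-tuple T -> \bar R) :
  measurable_fun setT p ->
  (forall A, measurable A -> pushforward Q p A = P A) ->
  measurable_fun setT f -> (forall t, 0 <= f t) ->
  \int[power_probability Q n]_t f [tuple p (tnth t i) | i < n] =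
  \int[power_probability P n]_t f t.
Proof.
move=> mp QP; elim: n f => [|n IH] f mf f0.
  rewrite /= !integral_dirac ?diracT ?mul1e//.
  - by congr f; apply: eq_from_tnth; case.
  - exact: (measurableT_comp mf (measurable_map_tuple mp)).
have mfp := measurableT_comp mf (measurable_map_tuple (n := n.+1) mp).
rewrite /= !ge0_integral_distribution//=.
rewrite (eq_integral (fun x =>
    f (tcons (p x.1, [tuple p (tnth x.2 i) | i < n])))); last first.
  by move=> x _; rewrite /= mktuple_tcons.
have mF : measurable_fun setT (f \o @tcons _ T n) by exact: measurableT_comp.
rewrite fubini_tonelli1//=; last first.
  have -> : (fun x => f (tcons (p x.1, [tuple p (tnth x.2 i) | i < n]))) =
     (fun t => f [tuple p (tnth t i) | i < n.+1]) \o @tcons _ T' n.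
    by apply/funext => x /=; rewrite mktuple_tcons.
  exact: measurableT_comp.
rewrite fubini_tonelli1//=.
pose F x := \int[power_probability P n]_y f (tcons (x, y)).
rewrite (eq_integral (F \o p)); last first.
  move=> x _ /=; rewrite /fubini_F /=.
  apply: (IH (fun t => f (tcons (p x, t)))) => //.
  exact: (measurable_fun_pair2 (p x) mF).
rewrite -(ge0_integral_pushforward mp _ measurableT)//.
- by apply: eq_measure_integral => A mA _; exact: QP.
- by apply: (measurable_fun_fubini_tonelli_F (f \o @tcons _ T n)) => //= ?.
- by move=> x _; exact: integral_ge0.
Qed.

End power_probability.

(** The integral of [g] is that of [f] plus that of [|g - f|]. The finite integral of [f] cancels,
    so equality means that [g - f] vanishes almost everywhere, and since [f <= g] the exceptional
    set is [f < g]. *)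
Lemma ge0_integral_eq_lt_null {dT : measure_display} {T : measurableType dT}
    {R : realType} (mu : {measure set T -> \bar R}) (f g : T -> R) :
  measurable_fun [set: T] f -> measurable_fun [set: T] g ->
  (forall x, 0 <= f x) -> (forall x, f x <= g x) ->
  (\int[mu]_x (f x)%:E)%E \is a fin_num ->
  (\int[mu]_x (f x)%:E = \int[mu]_x (g x)%:E)%E <->
  mu [set x | f x < g x] = 0%E.
Proof.
move=> mf mg f0 fg If.
have gf0 x : 0 <= g x - f x by rewrite subr_ge0.
have mgf : measurable_fun [set: T] (fun x => (g x - f x)%:E).
  by apply/measurable_EFinP; exact: measurable_funB.
have mEf : measurable_fun [set: T] (fun x => (f x)%:E) by apply/measurable_EFinP.
have mlt : measurable [set x | f x < g x].
  rewrite (_ : [set x | _] = [set: T] `&` (fun x => f x < g x) @^-1` [set true]).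
    exact: (measurable_fun_ltr mf mg measurableT).
  by rewrite setTI.
have Ig : (\int[mu]_x (g x)%:E =
    \int[mu]_x (f x)%:E + \int[mu]_x `|(g x - f x)%:E|)%E.
  rewrite [X in (_ + X)%E](eq_integral (fun x => (g x - f x)%:E)); last first.
    by move=> x _; rewrite gee0_abs ?lee_fin.
  rewrite -ge0_integralD//; try by move=> x _; rewrite lee_fin.
  by apply: eq_integral => x _; rewrite -EFinD addrC subrK.
have null_ae : mu [set x | f x < g x] = 0%E <->
    ae_eq mu [set: T] (fun x => (g x - f x)%:E) (cst 0%E).
  rewrite -(negligibleP _ mlt); split=> [h|].
    apply: negligibleS h => x /= /not_implyP[_]; apply: contra_notP.
    move=> /negP; rewrite -leNgt => gfx; congr EFin; apply/eqP.
    by rewrite subr_eq0 eq_le fg gfx.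
  apply: negligibleS => x /= fgx; apply/not_implyP; split=> //.
  by move=> [/eqP]; rewrite subr_eq0 gt_eqF.
apply: (iff_trans _ (iff_sym null_ae)).
apply: (iff_trans _ (ae_eq_integral_abs mu measurableT mgf)).
rewrite Ig; split=> [h|->]; last by rewrite adde0.
(* From [I = I + J] with [I] finite, [J] must be 0; the infinite cases are absurd. *)
move: h If; set I := integral _ _ _; set J := integral _ _ _.
by case: I J => [r| |] [s| |] //= [/eqP]; rewrite addrC -subr_eq subrr => /eqP <-.
Qed.

(** * Integration against the minibatch operator *)

Section minibatch_integral.
Variables (R : realType) (d N : nat).
Local Notation Z := (pairs R d).
Variables (N0 : (0 < N)%N) (S : {mfun N.-tuple Z >-> N.-tuple Z}).

Lemma measurable_tnth_mfun i : measurable_fun setT (fun z => tnth (S z) i).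
Proof. exact: (measurableT_comp (measurable_tnth i)). Qed.

Lemma ge0_integral_minibatch (gamma : probability Z R) (f : Z -> \bar R) :
  measurable_fun setT f -> (forall x, 0 <= f x)%E ->
  (\int[minibatch_OT N0 S gamma]_x f x =
  N%:R^-1%:E * \int[power_probability gamma N]_z \sum_(i < N) f (tnth (S z) i))%E.
Proof.
move=> mf f0.
pose S_ (i : 'I_N) : {mfun N.-tuple Z >-> Z} := HB.pack (fun z => tnth (S z) i)
  (isMeasurableFun.Build _ _ _ _ _ (measurable_tnth_mfun i)).
pose mS (i : 'I_N) : {measure set Z -> \bar R} :=
  distribution (power_probability gamma N) (S_ i).
(* [msum] is indexed by naturals; the zero measure is a default for indices from [N] on, which the
   sum never reaches. *)
pose m (k : nat) : {measure set Z -> \bar R} := oapp mS mzero (insub k).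
rewrite (eq_measure_integral (mscale (N%:R^-1)%:nng (msum m N))); last first.
  move=> A mA _; rewrite /mscale /msum /= /minibatch_measure /=.
  by congr (_ * _)%E; apply: eq_bigr => i _; rewrite /m valK.
rewrite ge0_integral_mscale//= ge0_integral_measure_sum//; congr (_ * _)%E.
rewrite ge0_integral_sum//; last first.
  by move=> i; exact: measurableT_comp mf (measurable_tnth_mfun i).
apply: eq_bigr => i _; rewrite /m valK /=.
by rewrite ge0_integral_distribution.
Qed.

End minibatch_integral.

(** * Euclidean norms: inequalities, measurability, continuity *)

Section euclidean.
Variables (R : realType) (d : nat).
Local Notation V := 'rV[R]_d.
Local Notation Z := (pairs R d).
Implicit Types (x y : V) (z w : Z).

Lemma enormE x : enorm x ^+ 2 = \sum_(k < d) x ord0 k ^+ 2.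
Proof. by rewrite sqr_sqrtr// sumr_ge0// => k _; exact: sqr_ge0. Qed.

Lemma enorm2E z : enorm2 z ^+ 2 = enorm z.1 ^+ 2 + enorm z.2 ^+ 2.
Proof. by rewrite sqr_sqrtr// addr_ge0// sqr_ge0. Qed.

Lemma enorm2N z : enorm2 (- z) = enorm2 z.
Proof.
rewrite /enorm2 !enormE; congr (Num.sqrt (_ + _));
  by apply: eq_bigr => k _; rewrite mxE sqrrN.
Qed.

(** The two sides differ by a nonnegative multiple of a square. A small [t] keeps the coefficient of
    [a ^+ 2] close to 1, at the price of [t^-1] on the increment [b]. *)
Lemma sqrD_le_weighted (a b t : R) : 0 < t ->
  (a + b) ^+ 2 <= (1 + t) * a ^+ 2 + (1 + t^-1) * b ^+ 2.
Proof.
move=> t0; rewrite -subr_ge0.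
rewrite (_ : _ - _ = t^-1 * (t * a - b) ^+ 2); last by field; rewrite gt_eqF.
by rewrite mulr_ge0 ?sqr_ge0// invr_ge0 ltW.
Qed.

Lemma enormD_le_weighted x y (t : R) : 0 < t ->
  enorm (x + y) ^+ 2 <= (1 + t) * enorm x ^+ 2 + (1 + t^-1) * enorm y ^+ 2.
Proof.
move=> t0; rewrite !enormE !mulr_sumr -big_split/=; apply: ler_sum => k _.
by rewrite mxE; exact: sqrD_le_weighted.
Qed.

(** By the parallelogram identity the gap is the squared norm of [x + y]. *)
Lemma enormB_le x y : enorm (x - y) ^+ 2 <= 2 * (enorm x ^+ 2 + enorm y ^+ 2).
Proof.
rewrite !enormE -big_split/= mulr_sumr; apply: ler_sum => k _.
rewrite !mxE -subr_ge0.
rewrite (_ : _ - _ = (x ord0 k + y ord0 k) ^+ 2) ?sqr_ge0//.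
by ring.
Qed.

Lemma measurable_coord (k : 'I_d) :
  measurable_fun [set: V] (fun x => x ord0 k : R).
Proof.
apply: (measurability _ (RGenOpens.measurableE R)).
move=> _ [_ [a [b ->]] <-]; rewrite setTI.
apply: sub_sigma_algebra.
apply: open_comp => [x _|]; first exact: coord_continuous.
exact: interval_open.
Qed.

Lemma measurable_enorm_sq {dT} {T : measurableType dT} (f : T -> V) :
  (forall k, measurable_fun [set: T] (fun t => f t ord0 k)) ->
  measurable_fun [set: T] (fun t => enorm (f t) ^+ 2).
Proof.
move=> mf; under eq_fun do rewrite enormE.
by apply: measurable_sum => k; exact: measurable_funX.
Qed.

Lemma measurable_cost : measurable_fun [set: Z] (fun z => enorm (z.1 - z.2) ^+ 2).
Proof.
apply: measurable_enorm_sq => k; under eq_fun do rewrite !mxE.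
by apply: measurable_funB; exact: measurableT_comp (measurable_coord k) _.
Qed.

Lemma measurable_enorm2_sq : measurable_fun [set: Z] (fun z => enorm2 z ^+ 2).
Proof.
under eq_fun do rewrite enorm2E.
apply: measurable_funD; apply: measurable_enorm_sq => k;
  exact: measurableT_comp (measurable_coord k) _.
Qed.

Lemma measurable_enorm2_diff_sq :
  measurable_fun [set: Z * Z] (fun u => enorm2 (u.1 - u.2) ^+ 2).
Proof.
under eq_fun do rewrite enorm2E.
apply: measurable_funD; apply: measurable_enorm_sq => k;
  under eq_fun do rewrite !mxE; apply: measurable_funB;
  apply: measurableT_comp (measurable_coord k) _; exact: measurableT_comp.
Qed.

Lemma continuous_cost : continuous (fun z => enorm (z.1 - z.2) ^+ 2).
Proof.
move=> z; rewrite (_ : (fun _ => _) =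
  (fun z : Z => \sum_(k < d) (z.1 ord0 k - z.2 ord0 k) ^+ 2)); last first.
  by apply/funext => w; rewrite enormE; apply: eq_bigr => k _; rewrite !mxE.
have c1 (k : 'I_d) : (fun w : Z => w.1 ord0 k) @ z --> z.1 ord0 k.
  apply: (@continuous_comp _ _ _ fst (fun x : V => x ord0 k)).
    exact: cvg_fst.
  exact: coord_continuous.
have c2 (k : 'I_d) : (fun w : Z => w.2 ord0 k) @ z --> z.2 ord0 k.
  apply: (@continuous_comp _ _ _ snd (fun x : V => x ord0 k)).
    exact: cvg_snd.
  exact: coord_continuous.
have cF (k : 'I_d) : (fun w : Z => (w.1 ord0 k - w.2 ord0 k) ^+ 2) @ z -->
    (z.1 ord0 k - z.2 ord0 k) ^+ 2 by apply: cvgM; apply: cvgB.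
(* The finite sum over coordinates converges by induction on its list of indices. *)
rewrite /continuous_at; elim: (index_enum _) => [|k s IH] /=.
  by under eq_fun do rewrite big_nil; rewrite big_nil; exact: cvg_cst.
by under eq_fun do rewrite big_cons; rewrite big_cons; exact: cvgD.
Qed.

(** * A countable basis of balls, and supports of plans *)

Lemma rV_ratr_dense x (e : R) : 0 < e ->
  exists q : 'rV[rat]_d, ball (map_mx (@ratr R) q) e x.
Proof.
(* Balls of ['rV[R]_d] are those of the sup norm, so a rational can be picked in each coordinate
   separately. *)
move=> e0; have h k : exists r : rat, ball (ratr r : R) e (x ord0 k).
  have [r] := @rat_in_itvoo R (x ord0 k - e) (x ord0 k + e) ltac:(lra).
  rewrite in_itv/= => /andP[h1 h2]; exists r.
  by rewrite /ball /= ltr_norml; apply/andP; split; lra.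
exists (\row_k sval (cid (h k))); split => // i k.
rewrite !mxE (ord1 i); exact: (svalP (cid (h k))).
Qed.

Lemma measurable_open_ball z (e : R) : measurable (ball z e).
Proof.
rewrite (_ : ball z e = ball z.1 e `*` ball z.2 e)//.
by apply: measurableX; apply: sub_sigma_algebra; exact: ball_open.
Qed.

(** Balls with rational centres and radii [k.+1%:R^-1], enumerated by [pickle]. Countability makes
    open sets measurable for the product sigma-algebra and the complement of a support
    negligible. *)
Lemma rational_ball_basis : exists B : nat -> set Z,
  (forall n, open (B n) /\ measurable (B n)) /\
  (forall (U : set Z) z, open U -> U z -> exists2 n, B n z & B n `<=` U).
Proof.
pose c (p : 'rV[rat]_d * 'rV[rat]_d) : Z :=
  (map_mx (@ratr R) p.1, map_mx (@ratr R) p.2).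
pose D (p : 'rV[rat]_d * 'rV[rat]_d * nat) := ball (c p.1) (p.2.+1%:R^-1 : R).
(* Naturals that encode no ball are sent to the empty set, itself open and measurable. *)
exists (fun n => oapp D set0 (unpickle n)); split.
  move=> n; case: unpickle => [p|] /=; last by split; [exact: open0|].
  by split; [exact: ball_open|exact: measurable_open_ball].
move=> U z oU Uz.
have /nbhs_ballP[e /= e0 zeU] : nbhs z U by exact: open_nbhs_nbhs.
(* The centre is within the radius of [z], so two radii must fit into [e] for the ball to stay in
   [U]. *)
have [k ke] : exists k : nat, k.+1%:R^-1 < e / 2.
  have [k _ /(_ k (leqnn k)) ?] :=
    near_infty_natSinv_lt (PosNum (divr_gt0 e0 (@ltr0Sn R 1))).
  by exists k.
have [q1 h1] := @rV_ratr_dense z.1 k.+1%:R^-1 ltac:(by rewrite invr_gt0).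
have [q2 h2] := @rV_ratr_dense z.2 k.+1%:R^-1 ltac:(by rewrite invr_gt0).
exists (pickle (q1, q2, k)); rewrite pickleK /=; first by split.
move=> w hw; apply: zeU; apply: (@le_ball _ _ _ (k.+1%:R^-1 + k.+1%:R^-1)).
  by rewrite [leRHS]splitr lerD// ltW.
by apply: ball_triangle hw; apply: ball_sym; split.
Qed.

Lemma open_measurable_pairs (U : set Z) : open U -> measurable U.
Proof.
move=> oU; have [B [mB BU]] := rational_ball_basis.
rewrite (_ : U = \bigcup_(n in [set n | B n `<=` U]) B n).
  by apply: bigcup_measurable => n _; exact: (mB n).2.
apply/seteqP; split=> [z Uz|z [n /= BnU /BnU//]].
by have [n Bnz BnU] := BU U z oU Uz; exists n.
Qed.

(** Every point outside the support has an open neighbourhood of measure zero, hence lies in a basis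
    set of measure zero; there are countably many of these. *)
Lemma negligible_setC_supp (gamma : probability Z R) :
  gamma.-negligible (~` supp gamma).
Proof.
have [B [mB BU]] := rational_ball_basis.
pose F n := if gamma (B n) == 0%E then B n else set0.
apply: (@negligibleS _ _ _ _ (\bigcup_n F n)).
  move=> z /= /existsNP[U /not_implyP[oU /not_implyP[Uz /negP]]].
  rewrite -leNgt => U0; have [n Bnz BnU] := BU U z oU Uz; exists n => //.
  rewrite /F ifT// -measure_le0; apply: le_trans U0.
  apply: le_measure; rewrite ?inE//; first exact: (mB n).2.
  exact: open_measurable_pairs.
apply: negligible_bigcup => n; rewrite /F; case: eqP => [B0|_].
  by apply/negligibleP => //; exact: (mB n).2.
exact: negligible_set0.
Qed.

Lemma measurable_supp (gamma : probability Z R) : measurable (supp gamma).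
Proof.
rewrite -[supp gamma]setCK; apply: measurableC; apply: open_measurable_pairs.
(* The complement of the support is open: a null neighbourhood of [z] serves all of its own
   points. *)
rewrite openE => z /= /existsNP[U /not_implyP[oU /not_implyP[Uz U0]]].
apply: (@filterS _ _ _ U); last exact: open_nbhs_nbhs.
by move=> w Uw; apply/existsNP; exists U => /(_ oU Uw).
Qed.

Lemma probability_supp (gamma : probability Z R) : gamma (supp gamma) = 1%E.
Proof.
have ms := measurable_supp gamma.
rewrite -[supp gamma]setCK probability_setC; last exact: measurableC.
have -> : gamma (~` supp gamma) = 0%E; last exact: sube0.
by apply/negligibleP; [exact: measurableC|exact: negligible_setC_supp].
Qed.

End euclidean.

(** * Stability of matching costs under perturbation of the batch *)

Section batch_cost.
Variables (R : realType) (d N : nat).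
Local Notation Z := (pairs R d).
Implicit Types (z : N.-tuple Z) (tau : 'S_N) (u v : Z).

Lemma batch_cost_perturb z z' tau (t : R) : 0 < t ->
  batch_cost z' tau <= (1 + t) * batch_cost z tau +
    2 * (1 + t^-1) * \sum_(i < N) enorm2 (tnth z' i - tnth z i) ^+ 2.
Proof.
move=> t0; pose D i := tnth z' i - tnth z i.
(* Reindexing the second components by [tau] gives the [i]-th summand exactly the increments
   occurring in the [i]-th matched pair. *)
have -> : \sum_(i < N) enorm2 (D i) ^+ 2 =
    \sum_(i < N) (enorm (D i).1 ^+ 2 + enorm (D (tau i)).2 ^+ 2).
  have perm_sum : \sum_(i < N) enorm (D (tau i)).2 ^+ 2 =
      \sum_(i < N) enorm (D i).2 ^+ 2.
    by rewrite [RHS](reindex_inj (@perm_inj _ tau)).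
  rewrite big_split/= perm_sum -big_split/=.
  by apply: eq_bigr => i _; rewrite enorm2E.
rewrite /batch_cost !mulr_sumr -big_split/=; apply: ler_sum => i _.
rewrite (_ : (tnth z' i).1 - (tnth z' (tau i)).2 =
  ((tnth z i).1 - (tnth z (tau i)).2) + ((D i).1 - (D (tau i)).2)); last first.
  by apply/rowP => k; rewrite !mxE; ring.
apply: (le_trans (enormD_le_weighted _ _ t0)).
rewrite lerD2l [2 * _]mulrC -mulrA ler_pM2l ?enormB_le//.
by rewrite addr_gt0// invr_gt0.
Qed.

(** Continuity of each of the [N] matched costs, with one radius for all indices since a finite
    intersection of neighbourhoods suffices. The form with eventually small [e] lets two
    permutations share a radius. *)
Lemma batch_cost_near z0 tau (a : R) : 0 < a ->
  \forall e \near 0^'+, forall z, (forall i, ball (tnth z0 i) e (tnth z i)) ->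
    `|batch_cost z0 tau - batch_cost z tau| <= N%:R * a.
Proof.
move=> a0.
have cost_near i : \forall e \near (0:R)^'+,
    forall u v, ball (tnth z0 i) e u -> ball (tnth z0 (tau i)) e v ->
    `|enorm ((tnth z0 i).1 - (tnth z0 (tau i)).2) ^+ 2 -
      enorm (u.1 - v.2) ^+ 2| <= a.
  (* Continuity is used at the mixed pair made of the first component of one point and the second
     component of another. *)
  have /cvgrPdist_le/(_ a a0)/nbhs_ballP[e /= e0 he] :=
    @continuous_cost R d ((tnth z0 i).1, (tnth z0 (tau i)).2).
  near=> e' => u v [u1 _] [_ v2].
  have ee' : e' <= e by near: e'; exact: nbhs_right_le.
  by apply: (he (u.1, v.2)); split; exact: le_ball ee' _ _.
near=> e => z hz.
rewrite /batch_cost -sumrB (le_trans (ler_norm_sum _ _ _))//.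
rewrite (_ : N%:R * a = \sum_(i < N) a); last first.
  by rewrite sumr_const card_ord mulr_natl.
apply: ler_sum => i _.
have H : forall i u v, ball (tnth z0 i) e u -> ball (tnth z0 (tau i)) e v ->
    `|enorm ((tnth z0 i).1 - (tnth z0 (tau i)).2) ^+ 2 -
      enorm (u.1 - v.2) ^+ 2| <= a.
  by near: e; exact: filter_forall.
exact: H.
Unshelve. all: by end_near. Qed.

Lemma batch_cost_lt_stable z0 tau sigma :
  batch_cost z0 tau < batch_cost z0 sigma ->
  exists2 e : R, 0 < e & forall z, (forall i, ball (tnth z0 i) e (tnth z i)) ->
    batch_cost z tau < batch_cost z sigma.
Proof.
(* Each of the two costs may move by [N%:R * a]; dividing by [N.+1] keeps twice this strictly below
   the gap. *)
move=> h; pose a := (batch_cost z0 sigma - batch_cost z0 tau) / (2 * N.+1%:R).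
have a0 : 0 < a by rewrite divr_gt0 ?subr_gt0 ?mulr_gt0.
have Na : 2 * (N%:R * a) < batch_cost z0 sigma - batch_cost z0 tau.
  have -> : batch_cost z0 sigma - batch_cost z0 tau = 2 * (N.+1%:R * a).
    by rewrite /a; field; rewrite nat1r.
  by rewrite !ltr_pM2l// ltr_pM2r// ltr_nat.
have [e [e0 [e1 e2]]] : exists e : R, 0 < e /\
    ((forall z, (forall i, ball (tnth z0 i) e (tnth z i)) ->
      `|batch_cost z0 tau - batch_cost z tau| <= N%:R * a) /\
     (forall z, (forall i, ball (tnth z0 i) e (tnth z i)) ->
      `|batch_cost z0 sigma - batch_cost z sigma| <= N%:R * a)).
  apply: (@filter_ex _ ((0 : R)^'+)).
  apply: filterI; first exact: nbhs_right_gt.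
  by apply: filterI; exact: batch_cost_near.
exists e => // z hz; move: (e1 z hz) (e2 z hz).
rewrite !ler_norml => /andP[h1 _] /andP[_ h2]; lra.
Qed.

End batch_cost.

(** * The minibatch map on batches, marginals and moments *)

Section minibatch.
Variables (R : realType) (d N : nat).
Local Notation Z := (pairs R d).
Variables (N0 : (0 < N)%N) (S : {mfun N.-tuple Z >-> N.-tuple Z}).
Hypothesis hS : minibatch_map S.
Local Notation F := (minibatch_OT N0 S).
Implicit Types (z : N.-tuple Z) (g : probability Z R).

(** The least matching cost of the batch, written through [S] so that it inherits measurability from
    [S]. *)
Definition minibatch_cost z : R :=
  \sum_(i < N) enorm ((tnth (S z) i).1 - (tnth (S z) i).2) ^+ 2.
Local Notation m := minibatch_cost.

Lemma minibatch_sum_fst {W : nmodType} (f : 'rV[R]_d -> W) z :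
  \sum_(i < N) f (tnth (S z) i).1 = \sum_(i < N) f (tnth z i).1.
Proof.
have [sigma [_ _ ->]] := hS.
by apply: eq_bigr => i _; rewrite tnth_mktuple.
Qed.

Lemma minibatch_sum_snd {W : nmodType} (f : 'rV[R]_d -> W) z :
  \sum_(i < N) f (tnth (S z) i).2 = \sum_(i < N) f (tnth z i).2.
Proof.
have [sigma [_ _ ->]] := hS.
rewrite [RHS](reindex_inj (@perm_inj _ (sigma z))).
by apply: eq_bigr => i _; rewrite tnth_mktuple.
Qed.

Lemma minibatch_cost_argmin z : exists2 sigma : 'S_N,
  m z = batch_cost z sigma & forall tau, batch_cost z sigma <= batch_cost z tau.
Proof.
have [sigma [_ hmin Sz]] := hS; exists (sigma z) => //.
by rewrite /minibatch_cost Sz; apply: eq_bigr => i _; rewrite tnth_mktuple.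
Qed.

Lemma minibatch_cost_le z tau : m z <= batch_cost z tau.
Proof. by have [sigma -> /(_ tau)] := minibatch_cost_argmin z. Qed.

Lemma minibatch_cost_ge0 z : 0 <= m z.
Proof. by apply: sumr_ge0 => i _; exact: sqr_ge0. Qed.

Lemma measurable_minibatch_cost : measurable_fun [set: N.-tuple Z] m.
Proof.
apply: measurable_sum => i.
exact: measurableT_comp (@measurable_cost R d) (measurable_tnth_mfun S i).
Qed.

Lemma measurable_batch_cost tau :
  measurable_fun [set: N.-tuple Z] (fun z => batch_cost z tau).
Proof.
apply: measurable_sum => i; apply: measurable_enorm_sq => k.
under eq_fun do rewrite !mxE.
apply: measurable_funB; apply: measurableT_comp (measurable_coord k) _.
  by apply: measurableT_comp => //; exact: measurable_tnth.
by apply: measurableT_comp => //; exact: measurable_tnth.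
Qed.

(** Applied to functions of [x] alone, of [y] alone, or sums of such: [S] keeps the first components
    and permutes the second ones, so the sum over the batch does not change. *)
Lemma integral_minibatch_invariant g (f : Z -> \bar R) :
  measurable_fun [set: Z] f -> (forall u, 0 <= f u)%E ->
  (forall z, \sum_(i < N) f (tnth (S z) i) = \sum_(i < N) f (tnth z i)) ->
  (\int[F g]_u f u = \int[g]_u f u)%E.
Proof.
move=> mf f0 fS; rewrite ge0_integral_minibatch//.
under eq_integral do rewrite fS.
rewrite ge0_integral_power_sum// muleA -EFinM mulVf ?mul1e//.
by rewrite pnatr_eq0 -lt0n.
Qed.

Lemma minibatch_marginals mu0 mu1 g :
  has_marginals mu0 mu1 g -> has_marginals mu0 mu1 (F g).
Proof.
move=> [g0 g1]; split => A mA; rewrite -?g0// -?g1//.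
- have mB : measurable ((fst : Z -> _) @^-1` A).
    by rewrite -[X in measurable X]setTI; exact: measurable_fst.
  (* Intersecting with [setT] puts both measures in the form of integrals of an indicator. *)
  rewrite /pushforward -[X in F g X]setIT -[X in g X]setIT.
  rewrite -!integral_indic//; apply: integral_minibatch_invariant => //.
  + exact/measurable_EFinP/measurable_indic.
  + by move=> z; exact: (minibatch_sum_fst (fun x => (\1_A x)%:E)).
- have mB : measurable ((snd : Z -> _) @^-1` A).
    by rewrite -[X in measurable X]setTI; exact: measurable_snd.
  rewrite /pushforward -[X in F g X]setIT -[X in g X]setIT.
  rewrite -!integral_indic//; apply: integral_minibatch_invariant => //.
  + exact/measurable_EFinP/measurable_indic.
  + by move=> z; exact: (minibatch_sum_snd (fun x => (\1_A x)%:E)).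
Qed.

Lemma minibatch_P2_plan g : P2_plan g -> P2_plan (F g).
Proof.
rewrite /P2_plan /finite_second_moment integral_minibatch_invariant//.
- by apply/measurable_EFinP; exact: measurable_enorm2_sq.
- by move=> u; rewrite lee_fin sqr_ge0.
- move=> z; rewrite !sumEFin; congr EFin.
  under eq_bigr do rewrite enorm2E.
  under [RHS]eq_bigr do rewrite enorm2E.
  rewrite !big_split/= (minibatch_sum_fst (fun x => enorm x ^+ 2)).
  by rewrite (minibatch_sum_snd (fun x => enorm x ^+ 2)).
Qed.

(** * Comparison of the transport costs before and after rematching *)

Lemma transport_cost_minibatch g :
  (transport_cost (F g) =
   N%:R^-1%:E * \int[power_probability g N]_z (m z)%:E)%E.
Proof.
rewrite /transport_cost ge0_integral_minibatch//.
- by under eq_integral do rewrite sumEFin.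
- by apply/measurable_EFinP; exact: measurable_cost.
- by move=> u; rewrite lee_fin sqr_ge0.
Qed.

(** Expresses the cost of [g] over the same batch measure as that of [F g], which reduces their
    comparison to a pointwise one between [m] and the identity matching. *)
Lemma transport_cost_power g :
  (transport_cost g =
   N%:R^-1%:E * \int[power_probability g N]_z (batch_cost z 1)%:E)%E.
Proof.
rewrite (eq_integral (fun z => \sum_(i < N)
    (enorm ((tnth z i).1 - (tnth z i).2) ^+ 2)%:E)); last first.
  move=> z _; rewrite sumEFin; congr EFin.
  by apply: eq_bigr => i _; rewrite perm1.
rewrite (@ge0_integral_power_sum _ _ _ _ _
  (fun u : Z => (enorm (u.1 - u.2) ^+ 2)%:E)).
- by rewrite muleA -EFinM mulVf ?mul1e// pnatr_eq0 -lt0n.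
- by apply/measurable_EFinP; exact: measurable_cost.
- by move=> u; rewrite lee_fin sqr_ge0.
Qed.

Lemma transport_cost_minibatch_le g :
  (transport_cost (F g) <= transport_cost g)%E.
Proof.
rewrite transport_cost_minibatch transport_cost_power.
apply: lee_wpmul2l; first by rewrite lee_fin invr_ge0.
apply: ge0_le_integral => //.
- by move=> z _; rewrite lee_fin minibatch_cost_ge0.
- by apply/measurable_EFinP; exact: measurable_minibatch_cost.
- by apply/measurable_EFinP; exact: measurable_batch_cost.
- by move=> z _; rewrite lee_fin minibatch_cost_le.
Qed.

Lemma transport_cost_fin_num g : P2_plan g -> transport_cost g \is a fin_num.
Proof.
move=> g2; rewrite ge0_fin_numE; last first.
  by apply: integral_ge0 => u _; rewrite lee_fin sqr_ge0.
apply: (@le_lt_trans _ _ (\int[g]_u (2%:E * (enorm2 u ^+ 2)%:E))%E).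
  apply: ge0_le_integral => //.
  - by move=> u _; rewrite lee_fin sqr_ge0.
  - by apply/measurable_EFinP; exact: measurable_cost.
  - apply/measurable_EFinP; apply: measurable_funM => //.
    exact: measurable_enorm2_sq.
  - by move=> u _; rewrite -EFinM lee_fin enorm2E enormB_le.
rewrite ge0_integralZl//.
- by rewrite lte_mul_pinfty.
- by apply/measurable_EFinP; exact: measurable_enorm2_sq.
- by move=> u _; rewrite lee_fin sqr_ge0.
Qed.

Lemma transport_cost_minibatch_fin_num g :
  P2_plan g -> transport_cost (F g) \is a fin_num.
Proof. by move=> /minibatch_P2_plan/transport_cost_fin_num. Qed.

(** * The equality case and cyclical monotonicity *)

Lemma transport_cost_minibatch_eq g : P2_plan g ->
  transport_cost (F g) = transport_cost g <-> N_cyclically_monotone_plan N g.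
Proof.
move=> g2; pose mlt := [set z | m z < batch_cost z 1].
have Ninv : (0 < N%:R^-1%:E :> \bar R)%E by rewrite lte_fin invr_gt0 ltr0n.
have mlt_measurable : measurable mlt.
  rewrite (_ : mlt = [set: N.-tuple Z] `&`
    (fun z => m z < batch_cost z 1) @^-1` [set true]); last by rewrite setTI.
  exact: (measurable_fun_ltr measurable_minibatch_cost
    (measurable_batch_cost 1) measurableT).
have supp_measurable :
    measurable [set z : N.-tuple Z | forall i, supp g (tnth z i)].
  apply: (@measurable_tuple_rectangle _ _ _ (fun=> supp g)) => _.
  exact: measurable_supp.
have b1E z : batch_cost z 1 =
    \sum_(i < N) enorm ((tnth z i).1 - (tnth z i).2) ^+ 2.
  by apply: eq_bigr => i _; rewrite perm1.
have : transport_cost (F g) = transport_cost g <-> power_probability g N mlt = 0%E.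
  have Im : (\int[power_probability g N]_z (m z)%:E)%E \is a fin_num.
    have := transport_cost_minibatch_fin_num g2; rewrite transport_cost_minibatch.
    have : (0 <= \int[power_probability g N]_z (m z)%:E)%E.
      by apply: integral_ge0 => z _; rewrite lee_fin minibatch_cost_ge0.
    (* An infinite integral would stay infinite after multiplication by the positive [N%:R^-1]. *)
    by case: (\int[_]_z _)%E => //= _; rewrite gt0_muley.
  have := ge0_integral_eq_lt_null measurable_minibatch_cost
    (measurable_batch_cost 1) minibatch_cost_ge0 (minibatch_cost_le^~ 1%g) Im.
  apply: iff_trans; rewrite transport_cost_minibatch transport_cost_power.
  split=> [/(congr1 (mule N%:R%:E))|-> //].
  by rewrite !muleA -EFinM mulfV ?mul1e// pnatr_eq0 -lt0n.
move=> ->; split=> [mlt0 z0 z0supp tau|mono].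
(* If [tau] beats the identity at a batch of support points, it does so on a product [B] of balls.
   Then [B] lies in the null set [mlt], yet its measure is a product of positive factors. *)
- rewrite -b1E leNgt; apply/negP => /batch_cost_lt_stable[e e0 he].
  pose B := [set z : N.-tuple Z | forall i, ball (tnth z0 i) e (tnth z i)].
  have mB : measurable B.
    apply: (@measurable_tuple_rectangle _ _ _ (fun i => ball (tnth z0 i) e)) => i.
    exact: measurable_open_ball.
  have : (power_probability g N B <= 0)%E.
    rewrite -mlt0; apply: le_measure; rewrite ?inE// => z /he.
    exact: le_lt_trans (minibatch_cost_le _ _).
  apply/negP; rewrite -ltNge.
  rewrite (power_probability_rectangle _ (A := fun i => ball (tnth z0 i) e)); last first.
    by move=> i; exact: measurable_open_ball.
  elim/big_ind : _ => [|x y x0 y0|i _]; first exact: lte01.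
  + exact: mule_gt0.
  + by apply: z0supp; [exact: ball_open|exact: ballxx].
(* Conversely, monotonicity makes the identity optimal on batches of support points, so [mlt] lies
   in the complement of a set of full measure. *)
- apply/eqP; rewrite -measure_le0.
  apply: (@le_trans _ _ (power_probability g N
      (~` [set z | forall i, supp g (tnth z i)]))).
    apply: le_measure; rewrite ?inE//; first exact: measurableC.
    move=> z /= mz zsupp; have [sigma mE _] := minibatch_cost_argmin z.
    have := mono z zsupp sigma; rewrite -b1E -/(batch_cost z sigma) -mE.
    by rewrite leNgt mz.
  rewrite probability_setC//.
  rewrite (power_probability_rectangle _ (A := fun=> supp g)); last first.
    by move=> _; exact: measurable_supp.
  by rewrite big1 ?subee// => i _; exact: probability_supp.
Qed.

(** * Perturbation of the minibatch cost along a coupling *)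

Lemma minibatch_cost_perturb z z' (t : R) : 0 < t ->
  m z' <= (1 + t) * m z +
    2 * (1 + t^-1) * \sum_(i < N) enorm2 (tnth z' i - tnth z i) ^+ 2.
Proof.
(* The permutation optimal for [z] is a competitor for [z']. *)
move=> t0; have [sigma -> _] := minibatch_cost_argmin z.
exact: le_trans (minibatch_cost_le z' sigma) (batch_cost_perturb _ _ _ t0).
Qed.

(** Integrates the pointwise perturbation bound against the [N]-th power of [pi]. With arbitrary
    maps [p] and [q] in place of the projections, one coupling serves in both directions. *)
Lemma transport_cost_minibatch_perturb (pi : probability (Z * Z)%type R)
    (p q : Z * Z -> Z) g g' (t : R) :
  measurable_fun [set: Z * Z] p -> measurable_fun [set: Z * Z] q ->
  (forall A, measurable A -> pushforward pi p A = g A) ->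
  (forall A, measurable A -> pushforward pi q A = g' A) ->
  measurable_fun [set: Z * Z] (fun u => enorm2 (q u - p u) ^+ 2) -> 0 < t ->
  (transport_cost (F g') <= (1 + t)%:E * transport_cost (F g) +
    (2 * (1 + t^-1))%:E * \int[pi]_u (enorm2 (q u - p u) ^+ 2)%:E)%E.
Proof.
move=> mp mq pig pig' mD t0; rewrite !transport_cost_minibatch.
have mE : measurable_fun [set: N.-tuple Z] (fun z => (m z)%:E).
  by apply/measurable_EFinP; exact: measurable_minibatch_cost.
have m0 z : (0 <= (m z)%:E)%E by rewrite lee_fin minibatch_cost_ge0.
have ED : measurable_fun [set: Z * Z] (fun u => (enorm2 (q u - p u) ^+ 2)%:E).
  exact/measurable_EFinP.
have D0 u : (0 <= (enorm2 (q u - p u) ^+ 2)%:E)%E by rewrite lee_fin sqr_ge0.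
have t1 : (0 <= (1 + t)%:E)%E by rewrite lee_fin addr_ge0// ltW.
have t2 : (0 <= (2 * (1 + t^-1))%:E)%E.
  by rewrite lee_fin mulr_ge0// addr_ge0// invr_ge0 ltW.
rewrite -(ge0_integral_power_map mp pig mE m0).
rewrite -(ge0_integral_power_map mq pig' mE m0).
(* The increments of the batch sum to [N] times the coupling cost, so the factor [N%:R^-1] can be
   pulled out of the whole inequality. *)
have Np : (N%:R^-1%:E * (N%:R%:E * \int[pi]_u (enorm2 (q u - p u) ^+ 2)%:E) =
    \int[pi]_u (enorm2 (q u - p u) ^+ 2)%:E)%E.
  by rewrite muleA -EFinM mulVf ?mul1e// pnatr_eq0 -lt0n.
have Ninv0 : (0 <= N%:R^-1%:E :> \bar R)%E by rewrite lee_fin invr_ge0.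
have mP := measurableT_comp mE (measurable_map_tuple (n := N) mp).
have mQ := measurableT_comp mE (measurable_map_tuple (n := N) mq).
rewrite -Np muleCA [X in (_ + X)%E]muleCA -ge0_muleDr; first last.
- by rewrite !mule_ge0// integral_ge0.
- by rewrite mule_ge0// integral_ge0.
apply: lee_wpmul2l => //.
rewrite -(ge0_integral_power_sum pi N ED D0).
have mS : measurable_fun [set: N.-tuple (Z * Z)%type]
    (fun w => \sum_(i < N) (enorm2 (q (tnth w i) - p (tnth w i)) ^+ 2)%:E)%E.
  by apply: emeasurable_sum => i; exact: measurableT_comp ED (measurable_tnth i).
have S0 (w : N.-tuple (Z * Z)%type) :
    (0 <= \sum_(i < N) (enorm2 (q (tnth w i) - p (tnth w i)) ^+ 2)%:E)%E.
  exact: sume_ge0.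
rewrite -(ge0_integralZl _ measurableT mP) => [|w _|//]; last exact: m0.
rewrite -(ge0_integralZl _ measurableT mS) => [|w _|//]; last exact: S0.
rewrite -ge0_integralD//.
- apply: ge0_le_integral => //.
  + by apply: emeasurable_funD; exact: measurable_funeM.
  + move=> w _; rewrite sumEFin -!EFinM -EFinD lee_fin.
    apply: le_trans (minibatch_cost_perturb [tuple p (tnth w i) | i < N] _ t0) _.
    rewrite lerD2l ler_pM2l.
      by apply: ler_sum => i _; rewrite !tnth_mktuple.
    by rewrite mulr_gt0// addr_gt0// invr_gt0.
- by move=> w _; apply: mule_ge0; last exact: m0.
- exact: measurable_funeM.
- by move=> w _; rewrite mule_ge0.
- exact: measurable_funeM.
Qed.

End minibatch.

(** * Continuity for the Wasserstein distance *)

Lemma W2_lt_coupling {dT : measure_display} {T : measurableType dT} {R : realType}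
    (dist : T -> T -> R) (mu nu : probability T R) (delta : R) : 0 < delta ->
  (W2 dist mu nu < delta%:E)%E ->
  exists2 pi : probability (T * T)%type R, has_marginals mu nu pi &
    (\int[pi]_z (dist z.1 z.2 ^+ 2)%:E < (delta ^+ 2)%:E)%E.
Proof.
move=> d0 W2d.
have /ereal_inf_lt[_ [pi pim <-] ltpi] : (ereal_inf [set \int[pi]_z
    ((dist z.1 z.2 ^+ 2)%:E) | pi in has_marginals mu nu] < (delta ^+ 2)%:E)%E.
  (* Were the infimum at least [delta ^+ 2], monotonicity of the square root would make [W2] at
     least [delta]. *)
  rewrite ltNge; apply: contraL W2d => le_inf; rewrite -leNgt /W2.
  have -> : delta%:E = ((delta ^+ 2)%:E `^ 2^-1)%E.
    by rewrite poweR_EFin powR12_sqrt ?sqr_ge0// sqrtr_sqr gtr0_norm.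
  have d20 : (0 <= (delta ^+ 2)%:E)%E by rewrite lee_fin sqr_ge0.
  apply: gt0_ler_poweR => //; first by rewrite in_itv/= d20 leey.
  by rewrite in_itv/= (le_trans d20 le_inf) leey.
by exists pi.
Qed.

Lemma minibatch_W2_continuous (R : realType) (d N : nat) (N0 : (0 < N)%N)
    (S : {mfun N.-tuple (pairs R d) >-> N.-tuple (pairs R d)}) :
  minibatch_map S ->
  W2_continuous (fun g => fine (transport_cost (minibatch_OT N0 S g))).
Proof.
move=> hS g g2 eps eps0; set a := fine _.
have Fg := transport_cost_minibatch_fin_num N0 hS g2.
have a0 : 0 <= a.
  by apply/fine_ge0/integral_ge0 => u _; rewrite lee_fin sqr_ge0.
(* Chosen to have both [t <= 1] and [4 * t * a <= eps]. *)
pose t := eps / (4 * (a + 1) + eps).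
have t0 : 0 < t by rewrite divr_gt0// addr_gt0// mulr_gt0// ltr_wpDl.
have t1 : t <= 1 by rewrite ler_pdivrMr; lra.
have ta : 4 * t * a <= eps.
  have -> : 4 * t * a = eps * (4 * a / (4 * (a + 1) + eps)).
    by rewrite /t; field; lra.
  by rewrite ger_pMr// ler_pdivrMr; lra.
pose c := 2 * (1 + t^-1).
have c0 : 0 < c by rewrite mulr_gt0// addr_gt0// invr_gt0.
have epsc0 : 0 < eps / (4 * c) by rewrite divr_gt0// mulr_gt0.
have delta0 : 0 < Num.sqrt (eps / (4 * c)) by rewrite sqrtr_gt0.
(* A coupling of cost [K] below the square of this radius satisfies [4 * (c * K) < eps]. *)
exists (Num.sqrt (eps / (4 * c))) => // g' g2' W2lt.
have Fg' := transport_cost_minibatch_fin_num N0 hS g2'.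
have [pi [pi1 pi2]] := W2_lt_coupling delta0 W2lt.
rewrite sqr_sqrtr ?ltW// => Kdelta.
have K0 : (0 <= \int[pi]_u (enorm2 (u.1 - u.2) ^+ 2)%:E)%E.
  by apply: integral_ge0 => u _; rewrite lee_fin sqr_ge0.
have Kfin : (\int[pi]_u (enorm2 (u.1 - u.2) ^+ 2)%:E)%E \is a fin_num.
  by rewrite ge0_fin_numE// (lt_trans Kdelta)// ltry.
have mD := @measurable_enorm2_diff_sq R d.
have enorm2C (u : pairs R d * pairs R d) : enorm2 (u.1 - u.2) = enorm2 (u.2 - u.1).
  by rewrite -enorm2N opprB.
have h1 := transport_cost_minibatch_perturb N0 hS measurable_snd measurable_fst
  pi2 pi1 mD t0.
have mD' : measurable_fun [set: pairs R d * pairs R d]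
  (fun u => enorm2 (u.2 - u.1) ^+ 2).
  by apply: eq_measurable_fun mD => u _; rewrite enorm2C.
have h2 := transport_cost_minibatch_perturb N0 hS measurable_fst measurable_snd
  pi1 pi2 mD' t0.
move: h2; under eq_integral do rewrite -enorm2C.
move: h1 Kdelta; rewrite -(fineK Fg) -(fineK Fg') -(fineK Kfin) -!EFinM -!EFinD.
rewrite !lee_fin lte_fin -/a -/c.
set b := fine _; set K := fine _ => h1 Kdelta h2.
have cK : 4 * (c * K) < eps.
  by have := Kdelta; rewrite ltr_pdivlMr ?(mulr_gt0 _ c0)// mulrCA [K * c]mulrC.
(* The bound on [a - b] involves [t * b], where [b] depends on [g']; inserting the bound on [b] and
   [t <= 1] gives at most [2 * t * a + 2 * (c * K)], which is below [eps]. The bound on [b - a] is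
   direct. *)
rewrite /= ltr_norml; apply/andP; split.
  have tcK : t * (c * K) <= c * K.
    by apply: ler_piMl => //; apply: mulr_ge0; [exact: ltW|exact: fine_ge0].
  have tta : t * (t * a) <= t * a.
    by apply: ler_piMl => //; apply: mulr_ge0 => //; exact: ltW.
  have tb : t * b <= t * ((1 + t) * a + c * K) by rewrite ler_pM2l.
  lra.
lra.
Qed.

Theorem proposition8 (R : realType) (d N : nat) (hN : (2 <= N)%N)
    (S : {mfun N.-tuple (pairs R d) >-> N.-tuple (pairs R d)})
    (hS : minibatch_map S)
    (mu0 mu1 : probability 'rV[R]_d R) (hmu0 : P2 mu0) (hmu1 : P2 mu1)
    (gamma : probability (pairs R d) R) (hgamma : Gamma mu0 mu1 gamma) :
  let F := minibatch_OT (ltnW hN) S in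
  [/\ Gamma mu0 mu1 (F gamma),
      (transport_cost (F gamma) <= transport_cost gamma)%E,
      transport_cost (F gamma) = transport_cost gamma <->
        N_cyclically_monotone_plan N gamma &
      (forall g, P2_plan g -> transport_cost (F g) \is a fin_num) /\
      W2_continuous (fun g => fine (transport_cost (F g)))].
Proof.
have [g2 gm] := hgamma; split.
- by split; [exact: minibatch_P2_plan|exact: minibatch_marginals].
- exact: transport_cost_minibatch_le.
- exact: transport_cost_minibatch_eq.
- by split; [exact: transport_cost_minibatch_fin_num|exact: minibatch_W2_continuous].
Qed.
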